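(* Let $2\leq p<\infty$ and let $G$ be a locally compact compactly generated group. Assume that there exists $\beta<1$ such that $V_G(r)\preceq e^{r^{\beta}}$. Then $$\alpha_{G,p}\geq 1-\beta.$$
   Context: **Setting.** Let $\mu$ be a left Haar measure on $G$, $S$ a compact symmetric generating subset, $|g|_S=\inf\{n\in\mathbb{N}: g\in S^n\}$ and $B(1,t)$ the ball of radius $t$ around $1$ for $|\cdot|_S$. The volume growth $V_G$ is (the $\approx$-class of) the function $r\mapsto\mu(B(1,r))$. For nondecreasing nonzero functions $f,g:\mathbb{R}_+\to[0,\infty]$, $f\preceq g$ means that there exists $C>0$ such that $f(t)=O(g(Ct))$ as $t\to\infty$; $f\approx g$ means $f\preceq g$ and $g\preceq f$. **Isoperimetric exponent.** For a function $\varphi$ on $G$ put $|\tilde{\nabla}\varphi|(g)=\sup_{s\in S}|\varphi(sg)-\varphi(g)|$, and $$J^b_{G,p}(t)=\sup_{\varphi}\frac{\|\varphi\|_p}{\|\tilde{\nabla}\varphi\|_p},$$ where the supremum is over all nonzero measurable functions $\varphi\in L^p(G,\mu)$ with support in $B(1,t)$. Define $$\alpha_{G,p}=\liminf_{t\to\infty}\frac{\log J^b_{G,p}(t)}{\log t}.$$ *)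

(* Defs.v *)
From HB Require Import structures.
From mathcomp Require Import all_boot all_order all_algebra.
From mathcomp Require Import all_classical all_reals all_analysis.
From mathcomp Require Import measurable_realfun.
Import Order.TTheory GRing.Theory Num.Theory.
Import numFieldNormedType.Exports.

Set Implicit Arguments.
Unset Strict Implicit.
Unset Printing Implicit Defensive.

Local Open Scope classical_set_scope.
Local Open Scope ring_scope.

(* The base point inherited from PointedTopological plays no role; it is only
   there because the library puts a generated sigma-algebra on pointed types. *)
HB.mixin Record isTopologicalGroup G & PointedTopological G & Group G := {
  mulg_continuous : continuous (fun x : G * G => (x.1 * x.2)%g) ;
  invg_continuous : continuous (fun x : G => (x^-1)%g)
}.

#[short(type="topologicalGroupType")]
HB.structure Definition TopologicalGroup :=
  {G of PointedTopological G & Group G & isTopologicalGroup G}.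

Notation borel G := (g_sigma_algebraType (@open G)).

Section word_metric.
Context {R : realType} {G : topologicalGroupType}.
Implicit Types (S : set G) (g : G).

Definition symmetric_set S := forall s, S s -> S (s^-1)%g.

Definition generating S := forall H : set G,
  H 1%g -> (forall g h, H g -> H h -> H (g * h)%g) ->
  (forall g, H g -> H (g^-1)%g) -> S `<=` H -> H = [set: G].

Fixpoint set_power S n : set G :=
  if n is m.+1 then [set (x.1 * x.2)%g | x in S `*` set_power S m]
  else [set 1%g].

Definition word_length S g : \bar R :=
  ereal_inf [set n%:R%:E | n in [set n : nat | set_power S n g]].

Definition word_ball S (t : R) : set G :=
  [set g | (word_length S g <= t%:E)%E].

End word_metric.

(* A left Haar measure: a nonzero left-invariant Radon measure on the Borel
   sigma-algebra. *)
Definition left_haar (R : realType) (G : topologicalGroupType)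
    (mu : {measure set (borel G) -> \bar R}) : Prop :=
  [/\ (0 < mu [set: G])%E,
      forall (g : G) (A : set (borel G)), measurable A ->
        mu [set (g * x)%g | x in (A : set G)] = mu A,
      forall K : set G, compact K -> (mu K < +oo)%E,
      forall A : set (borel G), measurable A ->
        mu A = ereal_inf [set mu U | U in [set U : set G | open U /\ A `<=` U]]
    & forall U : set G, open U ->
        mu U = ereal_sup [set mu K | K in [set K : set G | compact K /\ K `<=` U]]].

Definition volume_growth (R : realType) (G : topologicalGroupType)
    (mu : {measure set (borel G) -> \bar R}) (S : set G) (r : R) : \bar R :=
  mu (word_ball S r).

(* f(t) = O(g(Ct)) as t -> +oo, for functions with values in [0, +oo]. *)
Definition growth_le (R : realType) (f g : R -> \bar R) : Prop :=
  exists2 C : R, 0 < C & exists2 K : R, 0 < K &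
    \forall t \near +oo, (f t <= K%:E * g (C * t)%R)%E.

(* For nonmeasurable f >= 0 the library's integral is a lower integral, which
   is the wrong notion for a denominator: the gradient of a Borel function is a
   supremum over an uncountable set and need not be Borel. The least norm of a
   measurable majorant agrees with 'N[mu]_p[f] when f is measurable, see
   upper_LnormE. *)
Definition upper_Lnorm d (T : measurableType d) (R : realType)
    (mu : {measure set T -> \bar R}) (p : \bar R) (f : T -> \bar R) : \bar R :=
  ereal_inf [set 'N[mu]_p[psi]%E | psi in
    [set psi : T -> \bar R | measurable_fun [set: T] psi /\
                             forall x, (f x <= psi x)%E]].

Lemma upper_LnormE d (T : measurableType d) (R : realType)
    (mu : {measure set T -> \bar R}) (p : R) (f : T -> \bar R) :
  0 < p -> measurable_fun [set: T] f -> (forall x, 0 <= f x)%E ->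
  upper_Lnorm mu p%:E f = ('N[mu]_p%:E[f])%E.
Proof.
move=> p0 mf f0; apply/eqP; rewrite eq_le; apply/andP; split.
  by apply: ereal_inf_lbound; exists f.
apply: le_ereal_inf_tmp => _ [psi [mpsi fpsi] <-].
have mpow (h : T -> \bar R) : measurable_fun [set: T] h ->
    measurable_fun [set: T] (fun x => `|h x| `^ p)%E.
  move=> mh; apply: (measurableT_comp (measurable_poweR p)).
  exact: measurableT_comp.
have int_ge0 (h : T -> \bar R) :
    (\int[mu]_x (`|h x| `^ p))%E \in `[0%E, +oo%E].
  rewrite in_itv /= leey andbT; apply: integral_ge0 => x _.
  exact: poweR_ge0.
rewrite unlock /=; apply: (@gt0_ler_poweR R p^-1) => //.
  by rewrite invr_ge0 ltW.
apply: ge0_le_integral => //; [|exact: mpow|exact: mpow|].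
  by move=> x _; exact: poweR_ge0.
move=> x _; apply: (@gt0_ler_poweR R p); rewrite ?in_itv /= ?leey ?andbT ?abse_ge0 //.
  exact: ltW.
by rewrite !gee0_abs // (le_trans (f0 x)).
Qed.

Section isoperimetry.
Context {R : realType} {G : topologicalGroupType}.
Variables (mu : {measure set (borel G) -> \bar R}) (S : set G).
Local Open Scope ereal_scope.

(* The supremum is taken in [0, +oo] (hence is 0 if S is empty). *)
Definition gradient (phi : G -> R) (g : G) : \bar R :=
  maxe 0 (ereal_sup [set `|phi (s * g)%g - phi g|%:E | s in S]).

Definition isoperimetric_profile (p t : R) : \bar R :=
  ereal_sup [set 'N[mu]_p%:E[EFin \o phi] / upper_Lnorm mu p%:E (gradient phi) |
    phi in [set phi : borel G -> R |
      [/\ phi \in Lfun mu p%:E,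
          'N[mu]_p%:E[EFin \o phi] != 0 &
          closure [set g : G | phi g != 0%R] `<=` word_ball S t]]].

Definition isoperimetric_exponent (p : R) : \bar R :=
  limf_einf (fun t : R => lne (isoperimetric_profile p t) / (ln t)%:E)
            (pinfty_nbhs R).

End isoperimetry.

(* Main.v *)
(* Let l be the word norm and lam = A t^(beta - 1). The test function is
   phi = max(0, exp(-lam l) - exp(-lam t)): since l is 1-Lipschitz under left
   multiplication by S, its gradient is at most (exp lam - 1) exp(-lam l) on
   B(1, t + 1) and 0 elsewhere. On B(1, t/2) this is at most 2 (exp lam - 1) phi;
   outside, exp(-lam l) <= exp(-A t^beta / 2), and for A large (using p >= 2) the
   p-th power of this beats the volume of B(1, 2t). As ||phi||_p stays bounded
   below, ||phi||_p / ||grad phi||_p is at least of order 1 / lam ~ t^(1 - beta).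
   This needs beta > 0. If beta <= 0, then G has finite measure, the word norm is
   bounded, and constant functions make the profile infinite. *)

Require Import Defs.
From HB Require Import structures.
From mathcomp Require Import all_boot all_order all_algebra.
From mathcomp Require Import all_classical all_reals all_analysis.
From mathcomp Require Import measurable_realfun.
From mathcomp Require Import ring lra.
Import Order.TTheory GRing.Theory Num.Theory.
Import numFieldNormedType.Exports.

Set Implicit Arguments.
Unset Strict Implicit.
Unset Printing Implicit Defensive.

Local Open Scope classical_set_scope.
Local Open Scope ring_scope.

(** * The word norm of a symmetric generating set *)

Section word_norm.
Context {G : topologicalGroupType}.
Implicit Types (S : set G) (g h : G).

Lemma set_powerM S m n g h :
  set_power S m g -> set_power S n h -> set_power S (m + n) (g * h)%g.
Proof.
elim: m g => [|m IHm] g /=; first by move=> ->; rewrite mul1g add0n.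
move=> [[s x] [/= Ss Smx] <-] Snh; rewrite -mulgA.
by exists (s, (x * h)%g) => //=; split=> //=; exact: IHm.
Qed.

Lemma set_power1 S : set_power S 1 = S.
Proof.
apply/seteqP; split=> [_ [[s x] [/= Ss ->] <-]|s Ss]; first by rewrite mulg1.
by exists (s, 1%g) => //=; rewrite mulg1.
Qed.

Lemma set_powerV S n g :
  symmetric_set S -> set_power S n g -> set_power S n (g^-1)%g.
Proof.
move=> symS; elim: n g => [|n IHn] g /=; first by move=> ->; rewrite invg1.
move=> [[s x] [/= Ss Snx] <-]; rewrite invgM.
suff : set_power S (n + 1) (x^-1 * s^-1)%g by rewrite addn1.
by apply: set_powerM; [exact: IHn|rewrite set_power1; exact: symS].
Qed.

Lemma compact_set_power S n : compact S -> compact (set_power S n).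
Proof.
move=> cS; elim: n => [|n IHn] /=; first exact: compact_set1.
apply: continuous_compact; last exact: compact_setX.
by apply: continuous_subspaceT; exact: mulg_continuous.
Qed.

Lemma generating_set_power S g :
  symmetric_set S -> generating S -> exists n, set_power S n g.
Proof.
move=> symS genS.
suff SE : [set h | exists n, set_power S n h] = [set: G].
  by have : [set: G] g by []; rewrite -SE.
have /(_ [set h | exists n, set_power S n h]) := genS; apply => /=.
- by exists 0.
- by move=> x y [m Smx] [n Sny]; exists (m + n)%N; exact: set_powerM.
- by move=> x [n Snx]; exists n; exact: set_powerV.
- by move=> s Ss; exists 1; rewrite set_power1.
Qed.

(* Junk value 0 outside the subgroup generated by S. *)
Definition word_norm S g : nat :=
  xget 0 [set n | set_power S n g /\ forall m, set_power S m g -> (n <= m)%N].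

Section generating.
Variable S : set G.
Hypotheses (symS : symmetric_set S) (genS : generating S).

Lemma word_normP g : set_power S (word_norm S g) g /\
  forall m, set_power S m g -> (word_norm S g <= m)%N.
Proof.
rewrite /word_norm; case: xgetP => [n _ //|noex]; exfalso.
have exn : exists n, `[< set_power S n g >].
  by have [n Sn] := generating_set_power g symS genS; exists n; apply/asboolP.
case: (ex_minnP exn) => n /asboolP Sn nmin.
by apply: (noex n); split=> // m Sm; apply: nmin; apply/asboolP.
Qed.

Lemma word_norm_power g : set_power S (word_norm S g) g.
Proof. by have [] := word_normP g. Qed.

Lemma word_norm_le n g : set_power S n g -> (word_norm S g <= n)%N.
Proof. by have [_] := word_normP g; exact. Qed.

Lemma word_normM g h :
  (word_norm S (g * h)%g <= word_norm S g + word_norm S h)%N.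
Proof. by apply: word_norm_le; apply: set_powerM; exact: word_norm_power. Qed.

Lemma word_normV g : (word_norm S (g^-1)%g <= word_norm S g)%N.
Proof. by apply: word_norm_le; apply: set_powerV => //; exact: word_norm_power. Qed.

Lemma word_norm_subM g h :
  (word_norm S g <= word_norm S (g * h)%g + word_norm S h)%N.
Proof.
have gE : g = (g * h * h^-1)%g by rewrite mulgK.
rewrite {1}gE (leq_trans (word_normM _ _))// leq_add2l.
exact: word_normV.
Qed.

Lemma word_norm_mull s g : S s -> (word_norm S (s * g)%g <= (word_norm S g).+1)%N.
Proof.
move=> Ss; rewrite -add1n (leq_trans (word_normM _ _))// leq_add2r.
by apply: word_norm_le; rewrite set_power1.
Qed.

(** Multiplication by [s^-1], which lies in [S] by symmetry, undoes that by [s]. With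
    [word_norm_mull] this is the 1-Lipschitz property. *)
Lemma word_norm_mulr_ge s g :
  S s -> (word_norm S g <= (word_norm S (s * g)%g).+1)%N.
Proof.
have gE : g = (s^-1 * (s * g))%g by rewrite mulKg.
by move=> /symS Ss; rewrite {1}gE; exact: word_norm_mull.
Qed.

(** [S] may fail to contain [1], so its powers need not be nested: the ball is the union of the
    powers up to [n], not the last one. *)
Lemma compact_word_norm_le n :
  compact S -> compact [set g | (word_norm S g <= n)%N].
Proof.
move=> cS; suff -> : [set g | (word_norm S g <= n)%N] =
    \big[setU/set0]_(k < n.+1) set_power S k.
  by apply: bigsetU_compact => i _; exact: compact_set_power.
rewrite -(bigcup_mkord n.+1 (set_power S)); apply/seteqP; split=> g /=.
  by move=> gn; exists (word_norm S g) => //; exact: word_norm_power.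
by move=> [k /= kn Sk]; rewrite (leq_trans (word_norm_le Sk)).
Qed.

(** Since [S] generates, the infimum defining [word_length] is attained, and balls become conditions
    on a natural number. *)
Lemma word_ballE (R : realType) (t : R) :
  word_ball S t = [set g | (word_norm S g)%:R <= t].
Proof.
suff wE g : word_length S g = (word_norm S g)%:R%:E :> \bar R.
  by apply/seteqP; split=> g; rewrite /word_ball /= wE lee_fin.
apply/eqP; rewrite eq_le; apply/andP; split.
  by apply: ereal_inf_lbound; exists (word_norm S g) => //; exact: word_norm_power.
by apply: le_ereal_inf_tmp => _ [n Sn <-]; rewrite lee_fin ler_nat word_norm_le.
Qed.

Lemma compact_word_ball (R : realType) (t : R) :
  compact S -> compact (word_ball S t).
Proof.
rewrite word_ballE; have [t0|t0] := leP 0 t.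
  move=> /(@compact_word_norm_le (Num.truncn t)); congr compact.
  by apply/seteqP; split=> g /=; rewrite truncn_ge_nat.
suff -> : [set g | (word_norm S g)%:R <= t] = set0 by move=> _; exact: compact0.
by rewrite -subset0 => g /=; rewrite leNgt (lt_le_trans t0).
Qed.

End generating.
End word_norm.

(** * Borel measurability of functions of the word norm *)

Section measurability.
Context {G : topologicalGroupType} {S : set G}.
Hypotheses (hausdorff_G : hausdorff_space G) (compact_S : compact S).
Hypotheses (symS : symmetric_set S) (genS : generating S).

Lemma compact_measurable_borel (K : set G) :
  compact K -> measurable (K : set (borel G)).
Proof.
move=> /(compact_closed hausdorff_G) cK; rewrite -(setCK K).
apply: measurableC; apply: sub_sigma_algebra; exact: closed_openC.
Qed.

Lemma measurable_word_ball (R : realType) (t : R) :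
  measurable (word_ball S t : set (borel G)).
Proof. by apply: compact_measurable_borel; exact: compact_word_ball. Qed.

Lemma measurable_comp_word_norm d (T : measurableType d) (f : nat -> T) :
  measurable_fun [set: borel G] (fun g : borel G => f (word_norm S g)).
Proof.
have mle n : measurable ([set g | (word_norm S g <= n)%N] : set (borel G)).
  by apply: compact_measurable_borel; exact: compact_word_norm_le.
move=> _ Y mY; rewrite setTI.
(* The preimage is a countable union of spheres, each a compact ball minus all smaller ones; this
   form also covers [n = 0]. *)
have -> : (fun g : borel G => f (word_norm S g)) @^-1` Y =
    \bigcup_(n in [set n | Y (f n)]) ([set g | (word_norm S g <= n)%N] `\`
      \bigcup_(m in [set m | (m < n)%N]) [set g | (word_norm S g <= m)%N]).
  apply/seteqP; split=> [g Yg|g [n Yn [/= gn ngn]]] /=.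
    exists (word_norm S g) => //=; split=> //= -[m /= mg].
    by rewrite leqNgt mg.
  suff -> : word_norm S g = n by exact: Yn.
  apply/eqP; rewrite eqn_leq gn leqNgt; apply/negP => ltgn.
  by apply: ngn; exists (word_norm S g) => /=.
apply: bigcup_measurable => n _; apply: measurableD => //.
by apply: bigcup_measurable => m _; exact: mle.
Qed.

End measurability.

(** * Lower bounds for the profile and the exponent *)

Section profile.
Context {R : realType} {G : topologicalGroupType}.
Variables (mu : {measure set (borel G) -> \bar R}) (S : set G).
Local Open Scope ereal_scope.

(** One test function with a measurable majorant [psi] of its gradient suffices, because
    [upper_Lnorm] is an infimum over such majorants. Comparing integrals of [p]-th powers postpones
    the root to this proof. *)
Lemma isoperimetric_profile_ge (p t M : R) (phi psi : borel G -> R) :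
  (0 < p)%R -> (0 < M)%R ->
  measurable_fun setT phi -> measurable_fun setT psi ->
  (forall x, 0 <= phi x)%R -> (forall x, 0 <= psi x)%R ->
  closure [set g : G | phi g != 0%R] `<=` word_ball S t ->
  (forall g : G, gradient S (phi : G -> R) g <= (psi g)%:E) ->
  0 < \int[mu]_x (phi x `^ p)%:E < +oo ->
  \int[mu]_x (psi x `^ p)%:E <= (M `^ p)%:E * \int[mu]_x (phi x `^ p)%:E ->
  (M^-1)%:E <= isoperimetric_profile mu S p t.
Proof.
move=> p0 M0 mphi mpsi phi0 psi0 supp grad /andP[I0 Ioo] Ile.
have LE (f : borel G -> R) : (forall x, 0 <= f x)%R ->
    'N[mu]_p%:E[EFin \o f] = (\int[mu]_x (f x `^ p)%:E) `^ p^-1.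
  move=> f0; rewrite unlock; congr poweR; apply: eq_integral => x _ /=.
  by rewrite ger0_norm.
set I := \int[mu]_x (phi x `^ p)%:E in I0 Ioo Ile.
have [r rE] : exists r, I = r%:E.
  by exists (fine I); rewrite fineK// fin_numE gt_eqF ?lt_eqF// (lt_trans _ I0).
have r0 : (0 < r)%R by rewrite -lte_fin -rE.
have phiE : 'N[mu]_p%:E[EFin \o phi] = (r `^ p^-1)%:E.
  by rewrite LE// -/I rE poweR_EFin.
have psiE : 'N[mu]_p%:E[EFin \o psi] <= (M * r `^ p^-1)%:E.
  rewrite LE//; apply: (@le_trans _ _ ((M `^ p * r)%:E `^ p^-1)).
    apply: gt0_ler_poweR; rewrite ?in_itv ?invr_ge0 ?(ltW p0)//= ?leey ?andbT.
    - by apply: integral_ge0 => x _; rewrite lee_fin powR_ge0.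
    - by rewrite lee_fin mulr_ge0 ?powR_ge0 ?ltW.
    - by rewrite EFinM -rE.
  rewrite poweR_EFin powRM ?powR_ge0 ?(ltW r0)// -powRrM mulfV ?gt_eqF//.
  by rewrite powRr1 ?(ltW M0).
have rp0 : (0 < r `^ p^-1)%R by rewrite powR_gt0.
have up : upper_Lnorm mu p%:E (gradient S (phi : G -> R)) <= (M * r `^ p^-1)%:E.
  apply: le_trans psiE; apply: ereal_inf_lbound; exists (EFin \o psi) => //.
  split; first exact/measurable_EFinP.
  exact: grad.
apply: (@le_trans _ _ ('N[mu]_p%:E[EFin \o phi] /
    upper_Lnorm mu p%:E (gradient S (phi : G -> R)))); last first.
  apply: ereal_sup_ubound; exists phi => //; split=> //.
  - rewrite inE; apply/andP; split; rewrite inE//=.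
    by rewrite /finite_norm phiE ltry.
  - by rewrite phiE eqe gt_eqF.
have up0 : 0 <= upper_Lnorm mu p%:E (gradient S (phi : G -> R)).
  by apply: le_ereal_inf_tmp => _ [f _ <-]; exact: Lnorm_ge0.
rewrite phiE; apply: (@le_trans _ _ ((r `^ p^-1)%:E * (M * r `^ p^-1)%:E^-1)).
  rewrite inver gt_eqF ?mulr_gt0// -EFinM lee_fin invfM mulrCA mulfV ?gt_eqF//.
  by rewrite mulr1.
(* The denominator may be 0, with inverse [+oo]; inversion is decreasing on all of [0, [+oo]], so
   this needs no separate case. *)
rewrite lee_pmul2l ?fin_numE//.
by rewrite inve_ple ?inveK// inE ?inve_ge0// lee_fin mulr_ge0 ?ltW.
Qed.

(** Taking logarithms gives the quotient a lower bound [a + ln M / ln t], and the second term tends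
    to 0. *)
Lemma isoperimetric_exponent_ge (p a M : R) : (0 < M)%R ->
  (\forall t \near +oo%R, (M * t `^ a)%:E <= isoperimetric_profile mu S p t) ->
  a%:E <= isoperimetric_exponent mu S p.
Proof.
move=> M0 Jge; apply/lee_subgt0Pr => e e0.
rewrite /isoperimetric_exponent limf_einfE.
pose V := [set t : R | (1 < t)%R /\ (`|ln M| <= e * ln t)%R /\
  (M * t `^ a)%:E <= isoperimetric_profile mu S p t].
(* The lower limit is a supremum, over neighbourhoods of [+oo], of infima. On [V] the constant [M]
   costs at most [e]. *)
apply: (@le_trans _ _ (ereal_inf
    [set lne (isoperimetric_profile mu S p t) / (ln t)%:E | t in V])); last first.
  apply: ereal_sup_ubound; exists V => //.
  near=> t; split=> //; split; last by near: t.
  rewrite -ler_pdivrMl// -[leLHS]expRK ler_ln ?posrE ?expR_gt0//.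
apply: le_ereal_inf_tmp => _ [t [t1 [tM Jt]] <-].
have t0 : (0 < t)%R by rewrite (lt_trans _ t1).
have lnt0 : (0 < ln t)%R by rewrite ln_gt0.
have Mt0 : (0 < M * t `^ a)%R by rewrite mulr_gt0 ?powR_gt0.
apply: (@le_trans _ _ (lne (M * t `^ a)%:E / (ln t)%:E)); last first.
  rewrite inver gt_eqF// lee_pmul2r ?fin_numE ?lte_fin ?invr_gt0//.
  rewrite lee_lne ?in_itv//= leey andbT; first by rewrite lee_fin ltW.
  by rewrite (le_trans _ Jt)// lee_fin ltW.
rewrite lne_EFin// inver gt_eqF// -EFinM lee_fin ler_pdivlMr//.
rewrite lnM ?posrE ?powR_gt0// ln_powR mulrBl.
have := ler_norm (- ln M); rewrite normrN => ?; lra.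
Unshelve. all: by end_near.
Qed.

End profile.

(** * Haar measure of balls, and groups of finite measure *)

Section haar.
Context {R : realType} {G : topologicalGroupType} {S : set G}.
Variable mu : {measure set (borel G) -> \bar R}.
Hypotheses (hausdorff_G : hausdorff_space G) (compact_S : compact S).
Hypotheses (symS : symmetric_set S) (genS : generating S).
Hypothesis haar_mu : left_haar mu.

Let B (n : nat) : set (borel G) := word_ball S (n%:R : R).

Let mB n : measurable (B n). Proof. exact: measurable_word_ball. Qed.

(** The balls increase to [G] because [S] generates, so continuity from below applies. *)
Lemma measure_setT_le (x : \bar R) :
  (forall n : nat, mu (word_ball S (n%:R : R)) <= x)%E -> (mu [set: G] <= x)%E.
Proof.
move=> Bx.
have BT : \bigcup_n B n = setT.
  apply/seteqP; split=> // g _; exists (word_norm S g) => //.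
  by rewrite /B word_ballE /=.
have : (mu \o B) n @[n --> \oo] --> mu (\bigcup_n B n).
  apply: nondecreasing_cvg_mu => //; first by rewrite BT.
  move=> m n mn; apply/subsetPset => g; rewrite /B !word_ballE//= => gm.
  by rewrite (le_trans gm)// ler_nat.
rewrite BT => cvgB; rewrite -(cvg_lim _ cvgB)//.
apply: lime_le; first by apply/cvg_ex; exists (mu setT).
by apply: nearW => n; exact: Bx.
Qed.

Lemma measure_word_ball_lty (t : R) : (mu (word_ball S t) < +oo)%E.
Proof. by case: haar_mu => _ _ + _ _; apply; exact: compact_word_ball. Qed.

Lemma measure_word_ball_gt0 : exists n : nat, (0 < mu (word_ball S (n%:R : R)))%E.
Proof.
apply: contrapT => /forallNP mu0; case: haar_mu => muT _ _ _ _.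
suff : (mu [set: G] <= 0)%E by rewrite leNgt muT.
by apply: measure_setT_le => n; rewrite leNgt; apply/negP; exact: mu0.
Qed.

(* A translate of a ball B(n0) of positive measure by an element far from 1
   avoids B(m), so no ball comes within mu (B n0) of the total mass. *)
Lemma finite_haar_word_norm_bounded : (mu [set: G] < +oo)%E ->
  exists N : nat, forall g, (word_norm S g <= N)%N.
Proof.
move=> muT; apply: contrapT => /forallNP unb.
have [n0 mu0] := measure_word_ball_gt0.
have muB0 : mu (B n0) \is a fin_num.
  by rewrite ge0_fin_numE//; exact: measure_word_ball_lty.
suff : (mu [set: G] <= mu [set: G] - mu (B n0))%E.
  by rewrite leeBrDr// -leeBrDl ?ge0_fin_numE// subee ?ge0_fin_numE// leNgt mu0.
apply: measure_setT_le => m; rewrite leeBrDr//.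
have [g /negP] : exists g, ~ (word_norm S g <= m + n0)%N.
  by apply/existsNP; exact: unb.
rewrite -ltnNge => gm.
case: haar_mu => _ /(_ g (B n0) (mB n0)) <- _ _ _.
have mgB : measurable ([set (g * x)%g | x in (B n0 : set G)] : set (borel G)).
  apply: compact_measurable_borel => //; apply: continuous_compact.
    apply: continuous_subspaceT => x.
    apply: (@continuous_comp _ _ _ (fun x => (g, x))
      (fun x : G * G => (x.1 * x.2)%g)); last exact: mulg_continuous.
    by apply: cvg_pair; [exact: cvg_cst|exact: cvg_id].
  exact: compact_word_ball.
have mBm : measurable (word_ball S (m%:R : R) : set (borel G)) := mB m.
rewrite -measureU//.
  by apply: le_measure => //; rewrite inE//; exact: measurableU.
rewrite -subset0 => h /= [+ [x + xE]]; rewrite -{}xE /B !word_ballE//= !ler_nat.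
move=> gx x0; move: gm; rewrite ltnNge => /negP; apply.
by rewrite (leq_trans (word_norm_subM symS genS g x))// leq_add.
Qed.

Lemma finite_haar_exponent_ge (p a : R) : 0 < p -> (mu [set: G] < +oo)%E ->
  (a%:E <= isoperimetric_exponent mu S p)%E.
Proof.
move=> p0 muT; have [N HN] := finite_haar_word_norm_bounded muT.
apply: (@isoperimetric_exponent_ge _ _ _ _ p a 1) => //; near=> t.
have t0 : 0 < t by near: t; exact: nbhs_pinfty_gt.
have intT (c : R) : (\int[mu]_x (c `^ p)%:E = (c `^ p)%:E * mu setT)%E.
  by rewrite integral_cst.
rewrite mul1r -[t `^ a]invrK.
apply: (@isoperimetric_profile_ge _ _ _ _ p t _ (cst 1) (cst 0)) => //=.
- by rewrite invr_gt0 powR_gt0.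
- move=> g _; rewrite word_ballE//=.
  apply: (@le_trans _ _ N%:R); first by rewrite ler_nat HN.
  by near: t; exact: nbhs_pinfty_ge.
- move=> g; rewrite /gradient ge_max lexx/=; apply: ge_ereal_sup => _ [s _ <-].
  by rewrite subrr normr0.
- by rewrite intT powR1 mul1e muT andbT; case: haar_mu.
- by rewrite !intT powR0 ?gt_eqF// mul0e !mule_ge0// ?lee_fin ?powR_ge0.
Unshelve. all: by end_near.
Qed.

End haar.

(** * Two elementary real inequalities *)

Lemma expR_sub1_le (R : realType) (x : R) : expR x - 1 <= x * expR x.
Proof.
have := expR_ge1Dx (- x); rewrite expRN => xE.
have := ler_wpM2r (expR_ge0 x) xE; rewrite mulVf ?gt_eqF ?expR_gt0// => ?; lra.
Qed.

Lemma ler_dist_max0 (R : realType) (x y k : R) :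
  `|Num.max 0 (x - k) - Num.max 0 (y - k)| <= `|x - y|.
Proof.
rewrite /Order.max; case: (ltP 0 (x - k)) => ?; case: (ltP 0 (y - k)) => ?;
  rewrite ler_norml; case: (ger0P (x - y)) => ?; lra.
Qed.

(** * The truncated exponential as test function *)

Section exponential_profile.
Context {R : realType} {G : topologicalGroupType} {S : set G}.
Variable mu : {measure set (borel G) -> \bar R}.
Hypotheses (hausdorff_G : hausdorff_space G) (compact_S : compact S).
Hypotheses (symS : symmetric_set S) (genS : generating S).
Hypothesis haar_mu : left_haar mu.
Variables (lam t : R).
Hypotheses (lam0 : 0 < lam) (t1 : 1 <= t).

Let u (n : nat) : R := expR (- (lam * n%:R)).

Definition truncated_exp (n : nat) : R := Num.max 0 (u n - expR (- (lam * t))).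

(** The cutoff is [t + 1] and not [t], since one generator can bring a point from outside the
    support into it. *)
Definition truncated_exp_slope (n : nat) : R :=
  if n%:R <= t + 1 then (expR lam - 1) * u n else 0.

Let u0 n : 0 < u n. Proof. exact: expR_gt0. Qed.

Let uS m n : (n <= m.+1)%N -> u m <= expR lam * u n.
Proof.
move=> nm; rewrite /u -expRD ler_expR.
have : n%:R <= m.+1%:R :> R by rewrite ler_nat.
rewrite -natr1 => nm1; have := ler_wpM2l (ltW lam0) nm1; lra.
Qed.

Let elam : 1 <= expR lam. Proof. by rewrite -expR0 ler_expR ltW. Qed.

Lemma truncated_exp_ge0 n : 0 <= truncated_exp n.
Proof. by rewrite le_max lexx. Qed.

Lemma truncated_exp_slope_ge0 n : 0 <= truncated_exp_slope n.
Proof.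
by rewrite /truncated_exp_slope; case: ifP => // _; rewrite mulr_ge0 ?subr_ge0// ltW.
Qed.

Lemma truncated_exp_eq0 n : t <= n%:R -> truncated_exp n = 0.
Proof.
move=> tn; apply/max_idPl; rewrite subr_le0 ler_expR lerN2.
by rewrite ler_wpM2l// ltW.
Qed.

(** If [n > t + 1] then [m] and [n] both exceed [t] and both values vanish. Otherwise truncation
    does not increase distances, and [uS] compares [u m] with [u n] up to a factor [expR lam]. *)
Lemma truncated_exp_lipschitz m n : (m <= n.+1)%N -> (n <= m.+1)%N ->
  `|truncated_exp m - truncated_exp n| <= truncated_exp_slope n.
Proof.
move=> mn nm; rewrite /truncated_exp_slope; case: ifPn => [_|]; last first.
  rewrite -ltNge => tn; have : n%:R <= m.+1%:R :> R by rewrite ler_nat.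
  rewrite -natr1 => nm1; rewrite !truncated_exp_eq0 ?subrr ?normr0//; lra.
apply: (le_trans (ler_dist_max0 _ _ _)).
have := uS mn; have := uS nm; have := u0 m; have := u0 n.
rewrite ler_norml => un um nmE mnE; apply/andP; split; last lra.
(* When [u m < u n], [uS] bounds the difference by [(expR lam - 1) * u m], and [u m] is then
   replaced by the larger [u n]. *)
have [?|/ltW mn'] := leP (u n) (u m).
  by rewrite (@le_trans _ _ 0) ?oppr_le0 ?subr_ge0// mulr_ge0 ?subr_ge0// ltW.
have := ler_wpM2l (_ : 0 <= expR lam - 1) mn'; rewrite subr_ge0 => /(_ elam); lra.
Qed.

Lemma truncated_exp_le n (p : R) : 0 < p ->
  truncated_exp n `^ p <= (n%:R <= t)%R%:R.
Proof.
move=> p0; have [nt|/ltW tn] := leP n%:R t; last first.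
  by rewrite truncated_exp_eq0// powR0 ?gt_eqF.
apply: (@le_trans _ _ (1 `^ p)); last by rewrite powR1.
apply: ge0_ler_powR; rewrite ?nnegrE ?truncated_exp_ge0 ?(ltW p0)//.
rewrite ge_max ler01/= lerBlDr (@le_trans _ _ 1) ?lerDl ?expR_ge0//.
by rewrite /u -expR0 ler_expR oppr_le0 mulr_ge0// ltW.
Qed.

Section halved.
Hypothesis half : expR (- (lam * t / 2)) <= 2^-1.

(** The subtracted constant is the square of [expR (- (lam * t / 2))]: one factor is at most [u n],
    the other at most 1/2. *)
Lemma truncated_exp_ge n : n%:R <= t / 2 -> u n / 2 <= truncated_exp n.
Proof.
move=> nt; rewrite le_max; apply/orP; right.
have -> : - (lam * t) = - (lam * t / 2) + - (lam * t / 2) by lra.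
rewrite expRD; have : expR (- (lam * t / 2)) <= u n.
  by rewrite ler_expR lerN2 -mulrA ler_wpM2l ?(ltW lam0).
move=> uE; have := ler_pM (expR_ge0 _) (expR_ge0 _) uE half; lra.
Qed.

(** The first term handles [n <= t / 2], by [truncated_exp_ge]; the second handles larger [n], where
    [u n] is at most its value at [t / 2]. The radius [2 * t] covers [t + 1] because [1 <= t]. *)
Lemma truncated_exp_slope_powR_le n (p : R) : 0 < p ->
  truncated_exp_slope n `^ p <= (expR lam - 1) `^ p *
    (2 `^ p * truncated_exp n `^ p +
     expR (- (lam * t / 2)) `^ p * (n%:R <= 2 * t)%R%:R).
Proof.
move=> p0; rewrite /truncated_exp_slope; case: ifPn => [nt|_]; last first.
  by rewrite powR0 ?gt_eqF// !(mulr_ge0, addr_ge0, powR_ge0, ler0n).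
have -> : n%:R <= 2 * t by move: t1 => ?; apply: (le_trans nt); lra.
rewrite powRM ?subr_ge0 ?(ltW (u0 n))// ler_wpM2l ?powR_ge0//= mulr1.
have [nt2|/ltW nt2] := leP n%:R (t / 2).
  rewrite -powRM ?truncated_exp_ge0//.
  apply: (@le_trans _ _ ((2 * truncated_exp n) `^ p)); last by rewrite lerDl powR_ge0.
  apply: ge0_ler_powR; rewrite ?nnegrE ?mulr_ge0 ?truncated_exp_ge0 ?(ltW p0) ?(ltW (u0 n))//.
  have := truncated_exp_ge nt2; lra.
apply: (@le_trans _ _ (expR (- (lam * t / 2)) `^ p)).
  apply: ge0_ler_powR; rewrite ?nnegrE ?expR_ge0 ?(ltW p0)//.
  by rewrite ler_expR lerN2 -mulrA ler_wpM2l ?(ltW lam0).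
by rewrite lerDr mulr_ge0 ?powR_ge0.
Qed.

(** [K] controls the far part of the gradient and [d] bounds the integral [I] of the [p]-th power of
    the test function from below. The gradient integral is at most [(expR lam - 1)]^ p[times]2
    [^ p * I + K], and [K <= (K / d) * I]. *)
Lemma exponential_profile_ge (p K d : R) (n0 : nat) : 0 < p -> 0 < d ->
  0 < K -> n0%:R <= t / 2 ->
  ((expR (- (lam * t / 2)) `^ p)%:E * mu (word_ball S (2 * t)) <= K%:E)%E ->
  (d%:E <= ((u n0 / 2) `^ p)%:E * mu (word_ball S (n0%:R : R)))%E ->
  ((((expR lam - 1) * (2 `^ p + K / d) `^ p^-1)^-1)%:E <=
    isoperimetric_profile mu S p t)%E.
Proof.
move=> p0 d0 K0 n0t VK dV.
have p_neq0 : p != 0 by rewrite gt_eqF.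
have mB (r : R) : measurable (word_ball S r : set (borel G)).
  exact: measurable_word_ball.
have indicB (r : R) (g : G) :
    ((word_norm S g)%:R <= r)%R%:R = \1_(word_ball S r : set (borel G)) g :> R.
  rewrite indicE; congr (_ _); congr nat_of_bool.
  by apply/idP/idP; rewrite word_ballE// inE.
have mf (f : nat -> R) :
    measurable_fun setT (fun g : borel G => f (word_norm S g)).
  exact: measurable_comp_word_norm.
have mfp (f : nat -> R) :
    measurable_fun setT (fun g : borel G => (f (word_norm S g) `^ p)%:E).
  exact: (@measurable_comp_word_norm _ _ _ _ _ _ _ _ (fun n => (f n `^ p)%:E)).
have mi (c r : R) : measurable_fun setT
    (fun g : borel G => (c * \1_(word_ball S r : set (borel G)) g)%:E).
  by apply/measurable_EFinP; apply: measurable_funM.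
have intB (c r : R) : 0 <= c ->
    (\int[mu]_g (c * \1_(word_ball S r : set (borel G)) g)%:E =
     c%:E * mu (word_ball S r))%E.
  move=> c0; under eq_integral do rewrite EFinM.
  rewrite ge0_integralZl_EFin//; last first.
    by apply/measurable_EFinP; exact: measurable_indic.
  by rewrite integral_indic// setIT.
set I := (\int[mu]_g (truncated_exp (word_norm S g) `^ p)%:E)%E.
(* On the ball of radius [n0 <= t / 2] the test function is at least [u n0 / 2]. *)
have dI : (d%:E <= I)%E.
  apply: (le_trans dV); rewrite -intB ?powR_ge0//; apply: ge0_le_integral => //.
    by move=> g _; rewrite lee_fin mulr_ge0 ?powR_ge0.
  move=> g _; rewrite lee_fin -indicB; have [gn|_] := leP (word_norm S g)%:R n0%:R; last first.
    by rewrite mulr0 powR_ge0.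
  rewrite mulr1; apply: ge0_ler_powR.
  - exact: ltW.
  - by rewrite nnegrE divr_ge0// ltW.
  - by rewrite nnegrE truncated_exp_ge0.
  apply: le_trans (truncated_exp_ge _); last exact: le_trans n0t.
  by rewrite ler_pM2r ?invr_gt0// ler_expR lerN2 ler_wpM2l// ltW.
have Ioo : (I < +oo)%E.
  apply: (@le_lt_trans _ _ (1%:E * mu (word_ball S t)))%E.
    rewrite -intB//; apply: ge0_le_integral => //.
    - by move=> g _; rewrite lee_fin powR_ge0.
    by move=> g _; rewrite lee_fin mul1r -indicB truncated_exp_le.
  by rewrite mul1e; exact: measure_word_ball_lty.
have I0 : (0 < I)%E by apply: lt_le_trans dI.
have elam1 : 1 < expR lam by rewrite expR_gt1.
have D0 : 0 < 2 `^ p + K / d by rewrite addr_gt0 ?powR_gt0// divr_gt0.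
apply: (@isoperimetric_profile_ge _ _ _ _ p t _
    (fun g => truncated_exp (word_norm S g))
    (fun g => truncated_exp_slope (word_norm S g))) => //.
- by rewrite mulr_gt0 ?subr_gt0// powR_gt0.
- by move=> g; exact: truncated_exp_ge0.
- by move=> g; exact: truncated_exp_slope_ge0.
(* The ball is already closed, so taking the closure of the nonvanishing set does not leave it. *)
- have cB : closed (word_ball S t).
    by apply: compact_closed => //; exact: compact_word_ball.
  rewrite ((closure_id _).1 cB); apply: closure_subset => g /=.
  rewrite word_ballE//= leNgt; apply: contra => /ltW tg.
  by rewrite truncated_exp_eq0.
- move=> g; rewrite /gradient ge_max lee_fin truncated_exp_slope_ge0/=.
  apply: ge_ereal_sup => _ [s Ss <-]; rewrite lee_fin.
  by apply: truncated_exp_lipschitz; [exact: word_norm_mull|exact: word_norm_mulr_ge].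
- by rewrite I0 Ioo.
rewrite powRM ?subr_ge0 ?powR_ge0// -powRrM mulVf// powRr1 ?(ltW D0)//.
rewrite EFinM -muleA -/I.
have mtwo : measurable_fun setT (fun g : borel G =>
    (2 `^ p * truncated_exp (word_norm S g) `^ p)%:E).
  by under eq_fun do rewrite EFinM; exact: measurable_funeM.
apply: (@le_trans _ _ (\int[mu]_g (((expR lam - 1) `^ p)%:E *
  (((2 `^ p) * truncated_exp (word_norm S g) `^ p)%:E +
   (expR (- (lam * t / 2)) `^ p *
     \1_(word_ball S (2 * t) : set (borel G)) g)%:E)))%E).
  apply: ge0_le_integral => //.
  - by move=> g _; rewrite lee_fin powR_ge0.
  - by apply: measurable_funeM; exact: emeasurable_funD.
  by move=> g _; rewrite -EFinD -EFinM lee_fin -indicB truncated_exp_slope_powR_le.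
have two0 (g : borel G) : setT g ->
    (0 <= (2 `^ p * truncated_exp (word_norm S g) `^ p)%:E)%E.
  by move=> _; rewrite lee_fin mulr_ge0 ?powR_ge0.
have exp0 (g : borel G) : setT g -> (0 <= (expR (- (lam * t / 2)) `^ p *
     \1_(word_ball S (2 * t) : set (borel G)) g)%:E)%E.
  by move=> _; rewrite lee_fin mulr_ge0 ?powR_ge0.
rewrite ge0_integralZl_EFin ?powR_ge0//; last 2 first.
- by move=> g _; rewrite adde_ge0 ?two0 ?exp0.
- exact: emeasurable_funD.
rewrite lee_pmul2l ?lte_fin ?powR_gt0 ?subr_gt0//.
rewrite ge0_integralD// intB ?powR_ge0//.
under eq_integral do rewrite EFinM.
rewrite ge0_integralZl_EFin ?powR_ge0//; last first.
  by move=> g _; rewrite lee_fin powR_ge0.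
rewrite -/I EFinD ge0_muleDl ?lee_fin ?powR_ge0 ?divr_ge0 ?(ltW K0) ?(ltW d0)//.
apply: leeD => //; apply: (le_trans VK).
apply: (@le_trans _ _ ((K / d)%:E * d%:E)%E).
  by rewrite -EFinM divfK ?gt_eqF.
by rewrite lee_pmul2l ?lte_fin ?divr_gt0.
Qed.

End halved.
End exponential_profile.

(** * The two cases for [beta], and the choice of constants *)

Theorem proposition14 (R : realType) (G : topologicalGroupType)
    (hausdorff_G : hausdorff_space G)
    (locally_compact_G : locally_compact [set: G])
    (S : set G) (compact_S : compact S) (symmetric_S : symmetric_set S)
    (generating_S : generating S)
    (mu : {measure set (borel G) -> \bar R}) (haar_mu : left_haar mu)
    (p : R) (p_ge2 : 2 <= p) (beta : R) (beta_lt1 : beta < 1)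
    (growth : growth_le (volume_growth mu S)
                        (fun r => (expR (r `^ beta))%:E)) :
  ((1 - beta)%:E <= isoperimetric_exponent mu S p)%E.
Proof.
have p0 : 0 < p by lra.
have [C C0 [K K0 [N [_ VN]]]] := growth.
have [beta0|beta0] := leP beta 0.
  apply: finite_haar_exponent_ge => //.
  apply: (@le_lt_trans _ _ (K * expR 1)%:E); last exact: ltry.
  apply: (measure_setT_le _ _ symmetric_S generating_S) => // n.
  pose r := Num.max n%:R (Num.max (N + 1) C^-1).
  have [nr Nr Cr] : [/\ n%:R <= r, N < r & C^-1 <= r].
    rewrite /r !le_max !lt_max !lexx !orbT /=; split=> //.
    by apply/orP; right; apply/orP; left; lra.
  apply: (@le_trans _ _ (volume_growth mu S r)).
    apply: le_measure; rewrite ?inE; try exact: measurable_word_ball.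
    by rewrite !word_ballE// => g /= gn; exact: le_trans nr.
  apply: (le_trans (VN _ Nr)); rewrite -EFinM lee_fin ler_pM2l// ler_expR.
  rewrite -(powRr0 (C * r)) ler_powR//.
  by rewrite -ler_pdivrMl// mulr1.
have [n0 mu0] := measure_word_ball_gt0 hausdorff_G compact_S symmetric_S
  generating_S haar_mu.
have mu_fin := measure_word_ball_lty compact_S symmetric_S generating_S haar_mu
  n0%:R.
pose A := (2 * C) `^ beta + 4.
have A4 : 4 <= A by rewrite /A lerDr powR_ge0.
have A0 : 0 < A by lra.
pose m := fine (mu (word_ball S (n0%:R : R))).
have mE : mu (word_ball S (n0%:R : R)) = m%:E.
  by rewrite fineK// ge0_fin_numE.
have m0 : 0 < m by rewrite -lte_fin -mE.
(* Using [A >= lam] in place of [lam] makes [d], and hence [D], independent of [t]. *)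
pose d := (expR (- (A * n0%:R)) / 2) `^ p * m.
have d0 : 0 < d by rewrite mulr_gt0 ?powR_gt0 ?divr_gt0 ?expR_gt0.
pose D := (2 `^ p + K / d) `^ p^-1.
have D0 : 0 < D by rewrite powR_gt0// addr_gt0 ?powR_gt0// divr_gt0.
apply: (@isoperimetric_exponent_ge _ _ _ _ p _ (A * expR A * D)^-1).
  by rewrite invr_gt0 !mulr_gt0 ?expR_gt0//; lra.
near=> t.
have t1 : 1 <= t by near: t; exact: nbhs_pinfty_ge.
have t0 : 0 < t by lra.
have tn0 : n0%:R <= t / 2.
  by rewrite ler_pdivlMr//; near: t; exact: nbhs_pinfty_ge.
have tN : N < 2 * t.
  apply: (@lt_le_trans _ _ t); last lra.
  by near: t; apply: nbhs_pinfty_gt; exact: num_real.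
pose lam := A * t `^ (beta - 1).
have lam0 : 0 < lam by rewrite mulr_gt0 ?powR_gt0//; lra.
have lamA : lam <= A.
  rewrite /lam -[leRHS]mulr1 ler_pM2l; last lra.
  by rewrite -[leRHS](powRr0 t) ler_powR//; lra.
have lamt : lam * t = A * t `^ beta.
  rewrite /lam -mulrA -{2}(powRr1 (ltW t0)) -powRD ?(gt_eqF t0) ?implybT//.
  by rewrite subrK.
have tb1 : 1 <= t `^ beta by rewrite -[leLHS](powRr0 t) ler_powR// ltW.
have lamt4 : 4 <= lam * t by rewrite lamt; nra.
have e_half : expR (- (lam * t / 2)) <= 2^-1.
  rewrite expRN lef_pV2 ?posrE ?expR_gt0//.
  by have := expR_ge1Dx (lam * t / 2); lra.
have lamn0 : expR (- (A * n0%:R)) <= expR (- (lam * n0%:R)).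
  by rewrite ler_expR lerN2 ler_wpM2r.
apply: le_trans (exponential_profile_ge hausdorff_G compact_S symmetric_S
  generating_S haar_mu lam0 t1 e_half p0 d0 K0 tn0 _ _); last 2 first.
- apply: (@le_trans _ _ ((expR (- (lam * t)))%:E * volume_growth mu S (2 * t)%R)%E).
    apply: lee_wpmul2r; rewrite ?measure_ge0// lee_fin.
    (* Here [p >= 2] enters: the base is at most 1, so lowering the exponent to 2 increases the
       power, which becomes [expR (- (lam * t))]. *)
    apply: (@le_trans _ _ (expR (- (lam * t / 2)) `^ 2)).
      by apply: ger_powR => //; rewrite expR_gt0/= (le_trans e_half)//; lra.
    by rewrite powR_mulrn ?expR_ge0// expr2 -expRD ler_expR; lra.
  apply: (@le_trans _ _ ((expR (- (lam * t)))%:E *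
      (K%:E * (expR ((C * (2 * t)) `^ beta))%:E))%E).
    by apply: lee_wpmul2l; [rewrite lee_fin expR_ge0|exact: VN].
  rewrite -!EFinM lee_fin mulrCA -[leRHS]mulr1 ler_pM2l// -expRD -[leRHS]expR0 ler_expR.
  have -> : C * (2 * t) = 2 * C * t by ring.
  rewrite powRM ?(ltW t0) ?mulr_ge0 ?(ltW C0)// lamt /A.
  by have := powR_ge0 t beta; lra.
- rewrite mE -EFinM lee_fin ler_pM2r//; apply: ge0_ler_powR.
  + exact: ltW.
  + by rewrite nnegrE divr_ge0 ?expR_ge0.
  + by rewrite nnegrE divr_ge0 ?expR_ge0.
  + by rewrite ler_pM2r ?invr_gt0.
rewrite lee_fin -/D.
have tb : t `^ (1 - beta) = (t `^ (beta - 1))^-1 by rewrite -powRN opprB.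
rewrite tb -invfM lef_pV2 ?posrE ?mulr_gt0 ?(powR_gt0 _ t0) ?subr_gt0 ?expR_gt1 ?expR_gt0//.
have -> : A * expR A * D * t `^ (beta - 1) = lam * expR A * D by rewrite /lam; ring.
by rewrite ler_pM2r// (le_trans (expR_sub1_le lam))// ler_pM2l// ler_expR.
Unshelve. all: by end_near.
Qed.
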